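(* Let $A=-iH\in\mathbb{C}^{n\times n}$ be a skew-Hermitian matrix (so $H$ is Hermitian), let $v\in\mathbb{C}^n$ with $\|v\|=1$, and let $\tau>0$. Let $w_k(\tau)=V_ke^{i\tau T_k}e_1$ be the Lanczos approximation to $w(\tau)=e^{i\tau H}v$ obtained from $k$ steps of the Lanczos method for $H$ and $v$. Then, for any $q$ with $0<q<1$, $$\|w(\tau)-w_k(\tau)\|\le\frac{4\min\{1/(1-q^2),\ \tau\rho/q\}}{1-q}\,q^{k}\,e^{\tau\rho\left(\frac1q-q\right)},$$ where $\rho=(\lambda_{\max}(H)-\lambda_{\min}(H))/4$, with $\lambda_{\min}(H)$ and $\lambda_{\max}(H)$ the smallest and the largest eigenvalues of $H$ respectively.
   Context: $\|\cdot\|$ is the Euclidean norm. Lanczos method: starting from $v_1=v$ with $\|v\|=1$, $k$ steps applied to the Hermitian matrix $H$ produce an orthonormal set $\{v_1,\dots,v_k,v_{k+1}\}$ (a basis of $\operatorname{span}\{v,Hv,\dots,H^kv\}$), a $k\times k$ tridiagonal matrix $T_k=V_k^*HV_k$ and a number $\beta_{k+1}\ge 0$ such that $HV_k=V_kT_k+\beta_{k+1}v_{k+1}e_k^T$, where $V_k=[v_1,\dots,v_k]$ and $e_1,e_k$ are the first and $k$-th coordinate vectors of $\mathbb{R}^k$. *)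

(* Defs.v *)
From HB Require Import structures.
From mathcomp Require Import all_boot all_order all_algebra.
From mathcomp Require Import complex.
From mathcomp Require Import all_classical all_reals all_analysis.

Set Implicit Arguments.
Unset Strict Implicit.
Unset Printing Implicit Defensive.

Import Order.TTheory GRing.Theory Num.Theory.
Import numFieldNormedType.Exports.

Local Open Scope classical_set_scope.
Local Open Scope sesquilinear_scope.
Local Open Scope complex_scope.
Local Open Scope ring_scope.

(* The complex numbers as an explicit [numClosedFieldType]: the library puts a
   norm and a topology on every [numClosedFieldType], but none can be inferred
   for the bare carrier [R[i]]. *)
Definition CC (R : realType) : numClosedFieldType := R[i].

Definition l2norm (R : realType) (n : nat) (x : 'cV[CC R]_n) : R :=
  Num.sqrt (\sum_(i < n) ComplexField.Normc.normc (x i 0) ^+ 2).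

Definition expmx (R : realType) (n : nat) (M : 'M[CC R]_n) : 'M[CC R]_n :=
  limn (series (fun j : nat => (j`!%:R)^-1 *: M ^+ j)).

Definition evec_first (R : realType) (k : nat) : 'cV[CC R]_k :=
  \col_(i < k) (nat_of_ord i == 0)%N%:R.

Definition evec_last (R : realType) (k : nat) : 'cV[CC R]_k :=
  \col_(i < k) (i.+1 == k)%N%:R.

Definition krylov (R : realType) (n : nat) (H : 'M[CC R]_n) (v : 'cV[CC R]_n)
    (k : nat) : 'M[CC R]_(n, k) :=
  \matrix_(i < n, j < k) (H ^+ j *m v) i 0.

(* The columns of [B] are an orthonormal basis of span{v, Hv, ..., H^(k-1)v};
   [%MS] compares row spaces, hence the transposes. *)
Definition krylov_basis (R : realType) (n : nat) (H : 'M[CC R]_n)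
    (v : 'cV[CC R]_n) (k : nat) (B : 'M[CC R]_(n, k)) : Prop :=
  B^t* *m B = 1%:M /\ (B^T == (krylov H v k)^T)%MS.

Definition tridiagonal (R : realType) (k : nat) (T : 'M[CC R]_k) : Prop :=
  forall i j : 'I_k, (i.+1 < j)%N || (j.+1 < i)%N -> T i j = 0.

(* [V], [T], [beta], [u] are the data V_k, T_k, beta_{k+1}, v_{k+1} produced by
   [k] steps.  When beta_{k+1} = 0 the Krylov spaces have become stationary
   (always so for k = n), no v_{k+1} exists, and [u] is arbitrary. *)
Record lanczos (R : realType) (n : nat) (H : 'M[CC R]_n) (v : 'cV[CC R]_n)
    (k : nat) (V : 'M[CC R]_(n, k)) (T : 'M[CC R]_k) (beta : R)
    (u : 'cV[CC R]_n) : Prop := Lanczos {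
  lanczos_start : V *m evec_first R k = v;
  lanczos_basis : krylov_basis H v V;
  lanczos_tridiagonal : tridiagonal T;
  lanczos_projection : T = V^t* *m H *m V;
  lanczos_beta_ge0 : 0 <= beta;
  lanczos_relation :
    H *m V = V *m T + beta%:C *: (u *m (evec_last R k)^T);
  lanczos_next : beta != 0 -> krylov_basis H v (row_mx V u)
}.

Definition lanczos_approx (R : realType) (n k : nat) (V : 'M[CC R]_(n, k))
    (T : 'M[CC R]_k) (tau : R) : 'cV[CC R]_n :=
  V *m expmx (('i * tau%:C) *: T) *m evec_first R k.

(* All eigenvalues of a Hermitian matrix are real, so quantifying over real
   eigenvalues quantifies over all of them. *)
Definition is_lambda_min (R : realType) (n : nat) (H : 'M[CC R]_n) (l : R) :
    Prop :=
  eigenvalue H l%:C /\ forall mu : R, eigenvalue H mu%:C -> l <= mu.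

Definition is_lambda_max (R : realType) (n : nat) (H : 'M[CC R]_n) (l : R) :
    Prop :=
  eigenvalue H l%:C /\ forall mu : R, eigenvalue H mu%:C -> mu <= l.

(* Main.v *)
Require Import Defs.
From HB Require Import structures.
From mathcomp Require Import all_boot all_order all_algebra.
From mathcomp Require Import complex.
From mathcomp Require Import all_classical all_reals all_analysis.
From mathcomp Require Import ring lra.

Set Implicit Arguments.
Unset Strict Implicit.
Unset Printing Implicit Defensive.

Import Order.TTheory GRing.Theory Num.Theory.
Import numFieldNormedType.Exports.

Local Open Scope classical_set_scope.
Local Open Scope sesquilinear_scope.
Local Open Scope complex_scope.
Local Open Scope ring_scope.

(** The Lanczos approximation reproduces every polynomial of degree below [k]:
    since [T] is tridiagonal, the remainder term of the Lanczos relation is not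
    seen by [T ^+ j *m e_1] for [j < k - 1], so [p(H) v = V p(T) e_1] whenever
    [size p <= k] ([poly_mx_projection]). Hence, for every such [p], the error
    equals [(f - p)(H) v - V (f - p)(T) e_1] with [f x = e^(i tau x)]. Both [H]
    and [T] are unitarily diagonalizable, and the eigenvalues of the
    compression [T = V^* H V] lie between the extreme eigenvalues of [H]
    ([compression_eigenvalues_in]); so the error is at most twice the maximum
    of [|f - p|] on the spectral interval ([expmx_poly_mx_bound]).

    What remains is a scalar problem: approximate [e^(iy)] on [|y| <= 2 s],
    with [s = tau rho], by a polynomial of degree below [k] ([cis_poly_best]).
    If [s <= q], the Taylor polynomial does it, because [2 ^ j / j! <= 2] gives
    [(2 s)^j / j! <= 2 s^j] ([cis_taylor_bound]).

    If [q < s], truncate the expansion of [e^(iy)] in the Chebyshev polynomials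
    of [cos t], [y = 2 s cos t]. The coefficient of [2 cos (j t)] is
    [i^j J_j(2 s)] and must be bounded by [q^j e^(s (1/q - q))]. Rather than
    Bessel functions, the proof uses the powers [(1 + i y / m)^m]. One Euler
    step multiplies by [1 + 2 i h cos t], [h = s / m]; on the coefficients
    [b_j] with respect to the weighted waves [(i q)^j 2 cos (j t)] it acts as
    [1 + h L] with [(L b)_j = b_(j-1) / q - q b_(j+1)] ([shift_op]). The energy
    [b_0^2 / 2 + sum_(j > 0) b_j^2] satisfies [<b, L b> <= (1/q - q) <b, b>],
    because the two off-diagonal weights have opposite signs; this cancellation
    is what produces [1/q - q] and not [1/q + q]. So the energy after [m] steps
    is at most [e^(2 s (1/q - q) + O(1/m))] ([euler_coef_energy]), each [b_j],
    [j > 0], is at most [e^(s (1/q - q) + O(1/m))], and dropping the terms of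
    degree [k] and more costs the geometric tail [2 q^k / (1 - q)] times that
    ([chebyshev_truncation_error]). Since the minimum in the bound exceeds [1]
    when [q < s], some finite [m] already meets it. *)

(** * The coefficient recurrence and its energy *)

(** Half of the sum over all integers of an even summand, as for a cosine
    series, whose constant term carries the weight [1 / 2]. With [a = b] it is
    the energy; with [b] a sequence of functions it is a truncated expansion. *)
Definition half_pairing (K : fieldType) (a b : nat -> K) (N : nat) : K :=
  a 0%N * b 0%N / 2 + \sum_(0 <= j < N) a j.+1 * b j.+1.

Lemma half_pairingS (K : fieldType) (a b : nat -> K) N :
  half_pairing a b N.+1 = half_pairing a b N + a N.+1 * b N.+1.
Proof. by rewrite /half_pairing big_nat_recr //= addrA. Qed.

(** Coefficient side of the multiplication by [2 i cos t], with respect to the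
    functions [(i q)^j 2 cos (j t)]. *)
Definition shift_op (K : fieldType) (q : K) (b : nat -> K) (j : nat) : K :=
  if j is i.+1 then q^-1 * b i - q * b i.+2 else - 2 * q * b 1%N.

(** Summation by parts: [shift_op] is the transpose, for the pairing, of the
    multiplication by [z], up to boundary terms that vanish when [b] is
    supported below [N]. *)
Lemma half_pairing_shift (K : numFieldType) (q z : K) (b psi : nat -> K) N :
  z * psi 0%N = 2 * q^-1 * psi 1%N ->
  (forall j, z * psi j.+1 = q^-1 * psi j.+2 - q * psi j) ->
  z * half_pairing b psi N = half_pairing (shift_op q b) psi N
    + q^-1 * b N * psi N.+1 + q * b N.+1 * psi N.
Proof.
move=> psi0 psiS; elim: N => [|N IH].
  rewrite /half_pairing !big_geq //= !addr0.
  have -> : z * (b 0%N * psi 0%N / 2) = b 0%N * (z * psi 0%N) / 2 by ring.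
  by rewrite psi0; set r := q^-1; field.
rewrite !half_pairingS mulrDr IH /=.
have -> : z * (b N.+1 * psi N.+1) = b N.+1 * (z * psi N.+1) by ring.
by rewrite psiS; ring.
Qed.

Lemma subr_inv_ge0 (R : realFieldType) (q : R) :
  0 < q -> q < 1 -> 0 <= q^-1 - q.
Proof.
by move=> q0 q1; rewrite subr_ge0 (le_trans (ltW q1)) // invf_ge1 // ltW.
Qed.

Lemma half_pairing_le_tail (R : realFieldType) (b : nat -> R) N j :
  (j < N)%N -> b j.+1 ^+ 2 <= half_pairing b b N.
Proof.
move=> jN; rewrite /half_pairing big_mkord (bigD1 (Ordinal jN)) //=.
have -> : b 0%N * b 0%N / 2 = b 0%N ^+ 2 / 2 by ring.
rewrite -[b j.+1 * _]expr2.
have : 0 <= \sum_(i < N | i != Ordinal jN) b i.+1 * b i.+1.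
  by apply: sumr_ge0 => i _; rewrite -expr2 sqr_ge0.
have := sqr_ge0 (b 0%N); lra.
Qed.

(** The sign opposition of the two weights of [shift_op] leaves the factor
    [q^-1 - q] in front of the products of neighbours. *)
Lemma half_pairing_shift_self (R : realFieldType) (q : R) (b : nat -> R) N :
  half_pairing b (shift_op q b) N =
    (q^-1 - q) * (\sum_(0 <= j < N) b j * b j.+1) - q * b N * b N.+1.
Proof.
elim: N => [|N IH].
  by rewrite /half_pairing !big_geq //=; set r := q^-1; field.
by rewrite half_pairingS IH big_nat_recr //=; ring.
Qed.

(** By [2 x y <= x^2 + y^2]; each square is used twice, except those at
    the ends, which account for the half weight at [0] and for the last term. *)
Lemma sum_consecutive_le (R : realFieldType) (b : nat -> R) N :
  \sum_(0 <= j < N) b j * b j.+1 <= half_pairing b b N - b N ^+ 2 / 2.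
Proof.
elim: N => [|N IH].
  rewrite /half_pairing !big_geq //= addr0 -expr2; lra.
rewrite half_pairingS big_nat_recr //=.
have := sqr_ge0 (b N - b N.+1); lra.
Qed.

(** Only the boundedness of [shift_op] matters, since this term enters with the
    factor [h ^+ 2]; the negative term makes the induction on [N] go through. *)
Lemma half_pairing_shift_sqr (R : realFieldType) (q : R) (b : nat -> R) N :
  half_pairing (shift_op q b) (shift_op q b) N <=
    q^-1 ^+ 2 * (4 * half_pairing b b N - 2 * b N ^+ 2)
      + 2 * q ^+ 2 * half_pairing b b N.+1.
Proof.
elim: N => [|N IH].
  rewrite /half_pairing big_nat1 !big_geq //=.
  have := sqr_ge0 (q * b 0%N); lra.
rewrite half_pairingS [in leRHS]half_pairingS [in leRHS]half_pairingS /=.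
have := sqr_ge0 (q^-1 * b N + q * b N.+2).
have := sqr_ge0 (q^-1 * b N.+1).
rewrite half_pairingS in IH *.
move: IH; set E := half_pairing _ _ _; set F := half_pairing _ _ _.
lra.
Qed.

(** Expanding the square, the first order term is
    [2 h <b, L b> <= 2 h (q^-1 - q) <b, b>]. *)
Lemma energy_step (R : realFieldType) (q : R) (b : nat -> R) (h : R) N :
  0 < q -> q < 1 -> 0 <= h ->
  b N = 0 -> b N.+1 = 0 ->
  let b' j := b j + h * shift_op q b j in
  half_pairing b' b' N <=
    (1 + (2 * h * (q^-1 - q) + h ^+ 2 * (4 * q^-1 ^+ 2 + 2 * q ^+ 2)))
      * half_pairing b b N.
Proof.
move=> q0 q1 h0 bN bN1 /=.
have -> : half_pairing (fun j => b j + h * shift_op q b j)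
    (fun j => b j + h * shift_op q b j) N = half_pairing b b N
     + 2 * h * half_pairing b (shift_op q b) N
     + h ^+ 2 * half_pairing (shift_op q b) (shift_op q b) N.
  elim: N {bN bN1} => [|N IH]; last by rewrite !half_pairingS IH; ring.
  by rewrite /half_pairing !big_geq //=; set r := q^-1; field.
have d0 : 0 <= q^-1 - q := subr_inv_ge0 q0 q1.
have := half_pairing_shift_sqr q b N.
rewrite half_pairingS half_pairing_shift_self bN bN1.
have := sum_consecutive_le b N; rewrite bN.
set E := half_pairing b b N; set S := \sum_(0 <= j < N) _.
set F := half_pairing _ _ _ => SE FE.
have {}SE : h * (q^-1 - q) * S <= h * (q^-1 - q) * E.
  by apply: ler_wpM2l; [exact: mulr_ge0|lra].
have {}FE := ler_wpM2l (sqr_ge0 h) FE.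
lra.
Qed.

(** Coefficients of [(1 + 2 i h cos t) ^+ m] on the functions
    [(i q)^j 2 cos (j t)], see [euler_power_expansion]; the value [1] at index
    [0] stands for the constant [1], as the function of index [0] is [2] and
    has half weight. *)
Definition euler_coef (R : fieldType) (q h : R) (m : nat) : nat -> R :=
  iter m (fun b j => b j + h * shift_op q b j) (fun j => (j == 0)%N%:R).

Lemma euler_coef_support (R : fieldType) (q h : R) m j :
    (m < j)%N -> euler_coef q h m j = 0.
Proof.
elim: m j => [|m IH] [|j] //= mj.
have mj' : (m < j)%N by [].
rewrite -/(euler_coef q h m) (IH j) // (IH j.+1) 1?ltnW // (IH j.+2);
  last first.
  by rewrite ltnW // ltnW.
by ring.
Qed.

Lemma euler_coef_energy (R : realFieldType) (q h : R) m N :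
  0 < q -> q < 1 -> 0 <= h -> (m <= N)%N ->
  half_pairing (euler_coef q h m) (euler_coef q h m) N <=
    (1 + (2 * h * (q^-1 - q) + h ^+ 2 * (4 * q^-1 ^+ 2 + 2 * q ^+ 2))) ^+ m.
Proof.
move=> q0 q1 h0; elim: m => [|m IH] mN.
  rewrite /half_pairing big1 /=; first by rewrite mulr1 addr0 expr0; lra.
  by move=> i _; rewrite mulr0.
have bN : euler_coef q h m N = 0 by rewrite euler_coef_support.
have bN1 : euler_coef q h m N.+1 = 0 by rewrite euler_coef_support // ltnS ltnW.
apply: le_trans (energy_step q0 q1 h0 bN bN1) _; rewrite [leRHS]exprS.
apply: ler_wpM2l; last by apply: IH; exact: ltnW.
rewrite addr_ge0 // addr_ge0 //.
  by rewrite mulr_ge0 ?mulr_ge0 ?subr_inv_ge0.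
by rewrite mulr_ge0 ?sqr_ge0 // addr_ge0 // mulr_ge0 // sqr_ge0.
Qed.

(** * The unit circle and its Taylor polynomials *)

Local Notation cnorm := ComplexField.Normc.normc.

Lemma cnormE (R : rcfType) (a b : R) :
  cnorm (a +i* b)%C = Num.sqrt (a ^+ 2 + b ^+ 2).
Proof. by []. Qed.

Lemma cnorm_realC (R : realType) (x : R) : cnorm (x%:C : CC R) = `|x|.
Proof. by rewrite cnormE expr0n /= addr0 sqrtr_sqr. Qed.

Lemma cnorm_ge0 (R : realType) (z : CC R) : 0 <= cnorm z.
Proof. by case: z => a b; rewrite cnormE sqrtr_ge0. Qed.

Lemma iC (R : realType) : ('i : CC R) = (0 +i* 1)%C.
Proof. by rewrite -[LHS]complexiE. Qed.

Lemma cnorm_i (R : realType) : cnorm ('i : CC R) = 1.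
Proof. by rewrite iC cnormE expr0n /= add0r expr1n sqrtr1. Qed.

Lemma cnormM (R : realType) (x y : CC R) : cnorm (x * y) = cnorm x * cnorm y.
Proof. exact: ComplexField.Normc.normcM. Qed.

Lemma cnormD (R : realType) (x y : CC R) : cnorm (x + y) <= cnorm x + cnorm y.
Proof. exact: le_normcD. Qed.

Lemma cnormN (R : realType) (x : CC R) : cnorm (- x) = cnorm x.
Proof. exact: complex.normcN. Qed.

Lemma cnormX (R : realType) (x : CC R) n : cnorm (x ^+ n) = cnorm x ^+ n.
Proof.
elim: n => [|n IH]; last by rewrite !exprS cnormM IH.
by rewrite !expr0 -[1]/((1 : R)%:C) cnorm_realC normr1.
Qed.

Lemma cnorm_sum (R : realType) (I : Type) (r : seq I) (P : pred I)
    (F : I -> CC R) :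
  cnorm (\sum_(i <- r | P i) F i) <= \sum_(i <- r | P i) cnorm (F i).
Proof.
elim/big_rec2: _ => [|i x y _ le_yx].
  by rewrite -[0 in leLHS]/((0 : R)%:C) cnorm_realC normr0.
by rewrite (le_trans (cnormD _ _)) // lerD2l.
Qed.

Lemma cnorm_le_ReIm (R : realType) (a b : R) :
  cnorm (a +i* b)%C <= `|a| + `|b|.
Proof.
rewrite cnormE -[leRHS]ger0_norm ?addr_ge0 // -sqrtr_sqr ler_wsqrtr //.
rewrite sqrrD !real_normK ?num_real //.
have : 0 <= `|a| * `|b| by rewrite mulr_ge0.
lra.
Qed.

Definition cis (R : realType) (y : R) : CC R := (cos y +i* sin y)%C.

Lemma cnorm_cis (R : realType) (y : R) : cnorm (cis y) = 1.
Proof. by rewrite cnormE cos2Dsin2 sqrtr1. Qed.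

Lemma cisD (R : realType) (x y : R) : cis (x + y) = cis x * cis y.
Proof. by rewrite /cis cosD sinD; congr (_ +i* _)%C; ring. Qed.

Lemma cisMn (R : realType) (x : R) n : cis (x *+ n) = cis x ^+ n.
Proof.
elim: n => [|n IH]; last by rewrite mulrS cisD IH exprS.
by rewrite mulr0n expr0 /cis cos0 sin0.
Qed.

Definition expi_sum (R : realType) (N : nat) (y : R) : CC R :=
  \sum_(0 <= j < N) (j`!%:R)^-1 * ('i * y%:C) ^+ j.

(** The powers of ['i] alternate between the cosine and the sine series. *)
Lemma expi_term (R : realType) (y : R) j :
  (j`!%:R)^-1 * ('i * y%:C) ^+ j = (cos_coeff y j +i* sin_coeff y j)%C :> CC R.
Proof.
have -> : (j`!%:R)^-1 = ((j`!%:R)^-1 : R)%:C :> CC R.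
  by rewrite fmorphV /= rmorph_nat.
rewrite exprMn -[in ('i) ^+ _](odd_double_half j) exprD -mul2n exprM sqrCi.
rewrite /cos_coeff /sin_coeff /= -!exprnP -rmorphXn.
have -> : (-1) ^+ j./2 = (((-1) ^+ j./2 : R)%:C : CC R).
  by rewrite rmorphXn rmorphN1.
case: (boolP (odd j)) => oj /=; rewrite ?(mul1r, mul0r) ?expr1 ?expr0 ?mul1r.
  have -> : j.-1./2 = j./2.
    by rewrite -[in LHS](odd_double_half j) oj add1n /= doubleK.
  by rewrite iC; apply/eqP; rewrite eq_complex /=; apply/andP; split;
    apply/eqP; ring.
by apply/eqP; rewrite eq_complex /=; apply/andP; split; apply/eqP; ring.
Qed.

Lemma expi_sumE (R : realType) N (y : R) :
  expi_sum N y = (series (cos_coeff y) N +i* series (sin_coeff y) N)%C.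
Proof.
rewrite /expi_sum /series /=; elim: N => [|N IH]; first by rewrite !big_geq.
by rewrite !big_nat_recr //= IH expi_term.
Qed.

Lemma expi_sum_cvg (R : realType) (y : R) :
  (fun N => cnorm (cis y - expi_sum N y)) @ \oo --> (0 : R).
Proof.
have hc : series (cos_coeff y) @ \oo --> cos y.
  by rewrite unlock; exact: is_cvg_series_cos_coeff.
have hs : series (sin_coeff y) @ \oo --> sin y.
  by rewrite unlock; exact: is_cvg_series_sin_coeff.
apply: (@squeeze_cvgr _ _ _ _ (fun=> 0)
  (fun N => `|cos y - series (cos_coeff y) N| + `|sin y - series (sin_coeff y)
    N|)).
- apply: nearW => N; rewrite cnorm_ge0 /= expi_sumE.
  exact: cnorm_le_ReIm.
- exact: cvg_cst.
- rewrite -[X in _ --> X]addr0 -[X in _ --> X + _](normr0 R)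
  -[X in _ --> _ + X](normr0 R).
  apply: cvgD; apply: cvg_norm.
    by rewrite -[X in _ --> X](subrr (cos y)); apply: cvgB => //;
      exact: cvg_cst.
  by rewrite -[X in _ --> X](subrr (sin y)); apply: cvgB => //; exact: cvg_cst.
Qed.

Lemma cnorm_expi_sumB (R : realType) (y : R) k N : (k <= N)%N ->
  cnorm (expi_sum N y - expi_sum k y) <= \sum_(k <= j < N) `|y| ^+ j / j`!%:R.
Proof.
move=> kN; rewrite /expi_sum (big_cat_nat (leq0n k) kN) /= [X in cnorm X]addrC
  addKr.
apply: le_trans (cnorm_sum _ _ _) _; apply: ler_sum => j _.
rewrite cnormM cnormX cnormM cnorm_i mul1r cnorm_realC mulrC.
have -> : (j`!%:R)^-1 = ((j`!%:R)^-1 : R)%:C :> CC R.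
  by rewrite fmorphV /= rmorph_nat.
by rewrite cnorm_realC normfV normr_nat.
Qed.

(** The remainder is the limit of the partial sums beyond [k]. *)
Lemma cis_taylor (R : realType) (y c : R) k :
  (forall N, (k <= N)%N -> \sum_(k <= j < N) `|y| ^+ j / j`!%:R <= c) ->
  cnorm (cis y - expi_sum k y) <= c.
Proof.
move=> hc; rewrite -[c]add0r.
have h := expi_sum_cvg y.
have h2 : (fun N => cnorm (cis y - expi_sum N y) + c) @ \oo --> 0 + c.
  by apply: cvgD => //; exact: cvg_cst.
have h3 : (fun=> cnorm (cis y - expi_sum k y)) @ \oo --> cnorm
  (cis y - expi_sum k y).
  exact: cvg_cst.
apply: (ler_cvg_to h3 h2).
near=> N.
have kN : (k <= N)%N by near: N; exact: nbhs_infty_ge.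
have -> : cis y - expi_sum k y =
    (cis y - expi_sum N y) + (expi_sum N y - expi_sum k y) by ring.
apply: le_trans (cnormD _ _) _; rewrite lerD2l.
by apply: le_trans (cnorm_expi_sumB _ kN) _; exact: hc.
Unshelve. all: by end_near.
Qed.

Lemma sum_geometric_le (R : realFieldType) (q : R) k N :
  0 < q -> q < 1 -> \sum_(k <= j < N) q ^+ j <= q ^+ k / (1 - q).
Proof.
move=> q0 q1.
case: (leqP k N) => [kN|/ltnW Nk]; last first.
  by rewrite big_geq // divr_ge0 // ?exprn_ge0 ?subr_ge0 // ltW.
rewrite ler_pdivlMr ?subr_gt0 // mulr_suml.
have -> : \sum_(k <= j < N) q ^+ j * (1 - q) = q ^+ k - q ^+ N.
  rewrite -[RHS]opprB -telescope_sumr // -sumrN; apply: eq_bigr => j _.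
  by rewrite exprS; ring.
by rewrite gerBl exprn_ge0 // ltW.
Qed.

Lemma exp2_le_factS j : (2 ^ j <= j.+1`!)%N.
Proof.
elim: j => // j IH; rewrite expnS factS; apply: leq_mul => //.
Qed.

(** For [j > 0], [(2 s)^j / j! <= 2 s^j <= 2 (s / q) q^j], and the right-hand
    sides form a geometric series. *)
Lemma cis_taylor_bound (R : realType) (y s q : R) k :
  0 <= s -> s <= q -> q < 1 -> 0 < q -> `|y| <= 2 * s -> (0 < k)%N ->
  cnorm (cis y - expi_sum k y) <= 2 * (s / q) * (q ^+ k / (1 - q)).
Proof.
move=> s0 sq q1 q0 ys k0; apply: cis_taylor => N kN.
apply: le_trans (_ : \sum_(k <= j < N) 2 * (s / q) * q ^+ j <= _); last first.
  by rewrite -mulr_sumr ler_wpM2l ?sum_geometric_le // mulr_ge0 // divr_ge0 //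
    ltW.
rewrite big_nat [leRHS]big_nat; apply: ler_sum => j /andP[kj _].
case: j kj => [|j] kj; first by move: (leq_trans k0 kj).
have fact0 : 0 < j.+1`!%:R :> R by rewrite ltr0n fact_gt0.
rewrite ler_pdivrMr //.
have -> : 2 * (s / q) * q ^+ j.+1 = 2 * s * q ^+ j by rewrite exprS; field; lra.
apply: le_trans (_ : (2 * s) ^+ j.+1 <= _).
  by apply: lerXn2r; rewrite ?nnegrE // mulr_ge0.
rewrite exprS -[leRHS]mulrA; apply: ler_wpM2l; first by rewrite mulr_ge0.
rewrite exprMn mulrC.
apply: ler_pM; rewrite ?exprn_ge0 //.
  by apply: lerXn2r; rewrite ?nnegrE // ltW.
by rewrite -natrX ler_nat exp2_le_factS.
Qed.

(** * Expansion of the Euler powers in Chebyshev polynomials *)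

Fixpoint chebyshev (K : comNzRingType) (n : nat) : {poly K} :=
  if n is m.+1 then
    if m is l.+1 then 2 *: 'X * chebyshev K m - chebyshev K l else 'X
  else 1.

Lemma size_chebyshev (K : comNzRingType) n : (size (chebyshev K n) <= n.+1)%N.
Proof.
suff: (size (chebyshev K n) <= n.+1)%N /\ (size (chebyshev K n.+1) <= n.+2)%N.
  by case.
elim: n => [|n [IH1 IH2]]; first by rewrite size_poly1 size_polyX.
split=> //; rewrite
  -[chebyshev K n.+2]/(2 *: 'X * chebyshev K n.+1 - chebyshev K n).
rewrite (leq_trans (size_polyD _ _)) // geq_max size_polyN; apply/andP; split.
  rewrite -scalerAl (leq_trans (size_scale_leq _ _)) // mulrC.
  by rewrite (leq_trans (size_polyMleq _ _)) // size_polyX addn2.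
by rewrite (leq_trans IH1) // ltnW.
Qed.

Lemma cosMnSS (R : realType) (t : R) n :
  cos (t *+ n.+2) = 2 * cos t * cos (t *+ n.+1) - cos (t *+ n).
Proof.
have -> : t *+ n = t *+ n.+1 - t by rewrite mulrS; ring.
by rewrite mulrS addrC cosD cosB; ring.
Qed.

Lemma chebyshev_cos (R : realType) (t : R) n :
  (chebyshev (CC R) n).[(cos t)%:C] = (cos (t *+ n))%:C.
Proof.
suff: (chebyshev (CC R) n).[(cos t)%:C] = (cos (t *+ n))%:C /\
  (chebyshev (CC R) n.+1).[(cos t)%:C] = (cos (t *+ n.+1))%:C by case.
elim: n => [|n [IH1 IH2]].
  by rewrite /= !hornerE mulr0n cos0 mulr1n.
split=> //; rewrite
  -[chebyshev _ n.+2]/(2 *: 'X * chebyshev _ n.+1 - chebyshev _ n).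
by rewrite hornerD hornerN hornerM hornerZ hornerX IH1 IH2 cosMnSS
  rmorphB !rmorphM /= rmorph_nat.
Qed.

(** The factor [q ^ j] makes [half_pairing] of the coefficients an unweighted
    energy, and ['i ^ j] makes the coefficients real. *)
Definition wave (R : realType) (q t : R) (j : nat) : CC R :=
  ('i * q%:C) ^+ j * (2 * (cos (t *+ j))%:C).

Lemma wave0 (R : realType) (q t : R) : q != 0 ->
  2 * 'i * (cos t)%:C * wave q t 0 = 2 * (q%:C)^-1 * wave q t 1.
Proof.
move=> q0; have qC0 : q%:C != 0 :> CC R by rewrite fmorph_eq0.
by rewrite /wave mulr0n cos0 mulr1n expr0 expr1; field.
Qed.

Lemma waveS (R : realType) (q t : R) j : q != 0 ->
  2 * 'i * (cos t)%:C * wave q t j.+1 =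
    (q%:C)^-1 * wave q t j.+2 - q%:C * wave q t j.
Proof.
move=> q0; have qC0 : q%:C != 0 :> CC R by rewrite fmorph_eq0.
rewrite /wave cosMnSS rmorphB !rmorphM /= rmorph_nat !exprS.
have hi : 'i * 'i = -1 :> CC R by rewrite -expr2 sqrCi.
set c := (cos t)%:C; set d := (cos (t *+ j.+1))%:C; set e := (cos (t *+ j))%:C.
set w := _ ^+ j.
have -> : (q%:C)^-1 * ('i * q%:C * ('i * q%:C * w) * (2 * (2 * c * d - e))) =
  ('i * 'i) * q%:C * w * (2 * (2 * c * d - e)) :> CC R by field.
rewrite hi.
have -> : 2 * 'i * c * ('i * q%:C * w * (2 * d)) = ('i * 'i) *
  (4 * c * q%:C * w * d) :> CC R by ring.
by rewrite hi; ring.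
Qed.

Lemma cnorm_wave (R : realType) (q t : R) j : 0 <= q ->
  cnorm (wave q t j) <= 2 * q ^+ j.
Proof.
move=> q0; rewrite /wave cnormM cnormX cnormM cnorm_i mul1r cnorm_realC.
rewrite (ger0_norm q0) cnormM cnorm_realC.
have -> : (2 : CC R) = (2 : R)%:C by rewrite rmorph_nat.
rewrite cnorm_realC ger0_norm // [leRHS]mulrC.
apply: ler_wpM2l; first exact: exprn_ge0.
rewrite -[leRHS]mulr1; apply: ler_wpM2l => //.
by rewrite ler_norml cos_geN1 cos_le1.
Qed.

(** One more factor acts on the coefficients as [1 + h L]; the boundary terms of
    [half_pairing_shift] vanish as the coefficients of the [m]-th power are
    supported in [0..m]. *)
Lemma euler_power_expansion (R : realType) (q t h : R) m N :
  q != 0 -> (m <= N)%N ->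
  (1 + h%:C * (2 * 'i * (cos t)%:C)) ^+ m =
    half_pairing (fun j => (euler_coef q h m j)%:C) (wave q t) N :> CC R.
Proof.
move=> q0; elim: m => [|m IH] mN.
  rewrite /half_pairing /wave big1 /=; last by move=> i _; rewrite mul0r.
  by rewrite !expr0 cos0 mul1r mul1r addr0 mulr1 divff.
rewrite exprS {}IH 1?ltnW // mulrDl mul1r -mulrA.
rewrite (half_pairing_shift _ _ (wave0 _ q0) (fun j => waveS _ j q0)).
have -> : euler_coef q h m N = 0 by rewrite euler_coef_support.
have -> : euler_coef q h m N.+1 = 0 by rewrite euler_coef_support // ltnW.
rewrite !(mulr0, mul0r, addr0); elim: N {mN} => [|N IHN].
  rewrite /half_pairing !big_geq //= !addr0
    !(rmorphD, rmorphM, rmorphN, rmorph1).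
  ring.
rewrite !half_pairingS -{}IHN /= !(rmorphD, rmorphM, rmorphN, fmorphV) /=.
ring.
Qed.

(** * Polynomial approximation of the exponential *)

Lemma cnorm_subX (R : realType) (a b : CC R) (c : R) m :
  cnorm a <= c -> cnorm b <= c -> 1 <= c ->
  cnorm (a ^+ m - b ^+ m) <= m%:R * cnorm (a - b) * c ^+ m.
Proof.
move=> ac bc c1; have c0 : 0 <= c := le_trans ler01 c1.
elim: m => [|m IH].
  by rewrite !expr0 subrr -[0]/((0 : R)%:C) cnorm_realC normr0 !mul0r.
have -> : a ^+ m.+1 - b ^+ m.+1 = a * (a ^+ m - b ^+ m) + (a - b) * b ^+ m.
  by rewrite !exprS; ring.
apply: le_trans (cnormD _ _) _; rewrite !cnormM cnormX.
have h1 : cnorm a * cnorm (a ^+ m - b ^+ m) <= c *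
  (m%:R * cnorm (a - b) * c ^+ m).
  by apply: ler_pM => //; exact: cnorm_ge0.
have h2 : cnorm (a - b) * cnorm b ^+ m <= cnorm (a - b) * c ^+ m.+1.
  apply: ler_wpM2l; first exact: cnorm_ge0.
  apply: le_trans (_ : c ^+ m <= _).
    by apply: lerXn2r; rewrite ?nnegrE ?cnorm_ge0.
  by rewrite exprS ler_peMl // exprn_ge0.
apply: le_trans (lerD h1 h2) _; rewrite [in leRHS]mulrS exprS; lra.
Qed.

Lemma expR_ge_powD1 (R : realType) (x : R) n :
  0 <= x -> (1 + x) ^+ n <= expR (n%:R * x).
Proof.
move=> x0; rewrite expRM_natl; apply: lerXn2r; rewrite ?nnegrE ?expR_ge0 //.
  by rewrite addr_ge0.
exact: expR_ge1Dx.
Qed.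

(** Each of the [m] factors is off by at most [4 (s / m)^2], and products of the
    factors stay below [(1 + 2 s / m)^m <= e^(2 s)]. *)
Lemma cis_euler_power (R : realType) (s y : R) m :
  0 < s -> `|y| <= 2 * s -> (0 < m)%N -> 2 * s <= m%:R ->
  cnorm (cis y - (1 + 'i * (y / m%:R)%:C) ^+ m) <=
    4 * s ^+ 2 * expR (2 * s) / m%:R.
Proof.
move=> s0 ys m0 sm; have mR0 : 0 < m%:R :> R by rewrite ltr0n.
set x := y / m%:R; set h := s / m%:R.
have h0 : 0 < h by rewrite divr_gt0.
have h2 : h <= 2^-1 by rewrite ler_pdivrMr //; lra.
have xh : `|x| <= 2 * h.
  rewrite normrM normfV [`|m%:R|]gtr0_norm // mulrA; exact: ler_wpM2r.
have e2 : expi_sum 2 x = 1 + 'i * x%:C.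
  by rewrite /expi_sum big_nat_recr //= big_nat1 expr0 expr1 !fact0 !invr1
    !mul1r.
have step : cnorm (cis x - (1 + 'i * x%:C)) <= 4 * h ^+ 2.
  (* The first order Taylor bound, with the free ratio chosen equal to h. *)
  rewrite -e2; apply: le_trans (cis_taylor_bound (q := h) _ _ _ _ xh _) _ => //.
  - exact: ltW.
  - lra.
  rewrite divff ?gt_eqF // mulr1 mulrA ler_pdivrMr; last lra.
  have h20 := sqr_ge0 h.
  have : h ^+ 2 * h <= h ^+ 2 * 2^-1 by apply: ler_wpM2l.
  lra.
have -> : cis y = cis x ^+ m.
  by rewrite -cisMn -[x *+ m]mulr_natr /x divfK // gt_eqF.
apply: le_trans (cnorm_subX (c := 1 + 2 * h) _ _ _ _) _.
- rewrite cnorm_cis; lra.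
- apply: le_trans (cnormD _ _) _; rewrite cnormM cnorm_i mul1r cnorm_realC.
  by rewrite -[1 in leLHS]/((1 : R)%:C) cnorm_realC normr1 lerD2l.
- lra.
have p1 : (1 + 2 * h) ^+ m <= expR (2 * s).
  apply: le_trans (expR_ge_powD1 _ _) _; first lra.
  have -> : m%:R * (2 * h) = 2 * s by rewrite /h; field; rewrite gt_eqF.
  exact: lexx.
have -> : 4 * s ^+ 2 * expR (2 * s) / m%:R = m%:R * (4 * h ^+ 2) * expR (2 * s).
  by rewrite /h; field; rewrite gt_eqF.
apply: ler_pM => //.
- by rewrite mulr_ge0 ?cnorm_ge0.
- apply: exprn_ge0; lra.
- by apply: ler_wpM2l.
Qed.

(** The expansion of the [m]-th Euler power kept up to degree [k], as a
    polynomial in [y = 2 s cos t]. *)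
Definition chebyshev_truncation (R : realType) (q s h : R) (m k : nat) :
    {poly CC R} :=
  (euler_coef q h m 0)%:C%:P + \sum_(0 <= j < k)
    ((euler_coef q h m j.+1)%:C * (2 * ('i * q%:C) ^+ j.+1)) *:
      (chebyshev (CC R) j.+1 \Po (((2 * s)^-1)%:C *: 'X)).

Lemma size_chebyshev_truncation (R : realType) (q s h : R) (m k : nat) :
  (size (chebyshev_truncation q s h m k) <= k.+1)%N.
Proof.
rewrite (leq_trans (size_polyD _ _)) // geq_max; apply/andP; split.
  by rewrite (leq_trans (size_polyC_leq1 _)).
rewrite big_nat; elim/big_ind: _ => [|p p' hp hp'|j /andP[_ jk]].
- by rewrite size_poly0.
- by rewrite (leq_trans (size_polyD _ _)) // geq_max hp.
rewrite (leq_trans (size_scale_leq _ _)) //.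
rewrite (leq_trans (size_comp_poly_leq _ _)) // ltnS.
rewrite (leq_trans _ jk) // -[leqRHS]muln1; apply: leq_mul.
  by rewrite -subn1 leq_subLR size_chebyshev.
by rewrite -subn1 leq_subLR (leq_trans (size_scale_leq _ _)) ?size_polyX.
Qed.

Lemma horner_chebyshev_truncation (R : realType) (q s h t : R) (m k : nat) :
  s != 0 ->
  (chebyshev_truncation q s h m k).[(2 * s * cos t)%:C] =
    half_pairing (fun j => (euler_coef q h m j)%:C) (wave q t) k.
Proof.
move=> s0; rewrite /chebyshev_truncation /half_pairing hornerD hornerC
  horner_sum.
congr (_ + _).
  by rewrite /wave mulr0n cos0 expr0 mul1r mulr1 mulfK // pnatr_eq0.
apply: eq_bigr => j _; rewrite hornerZ horner_comp hornerZ hornerX.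
rewrite -rmorphM mulKf ?mulf_neq0 ?pnatr_eq0 // chebyshev_cos /wave.
by rewrite !mulrA; congr (_ * _); rewrite -!mulrA; congr (_ * _); rewrite mulrC.
Qed.

(** A wave of index [j] has size at most [2 q^j], so the discarded part is a
    geometric tail. *)
Lemma half_pairing_wave_tail (R : realType) (q t B : R) (b : nat -> R) k N :
  0 < q -> q < 1 -> (k <= N)%N -> (forall j, (j < N)%N -> `|b j.+1| <= B) ->
    0 <= B ->
  cnorm (half_pairing (fun j => (b j)%:C) (wave q t) N
    - half_pairing (fun j => (b j)%:C) (wave q t) k) <=
    2 * (q ^+ k.+1 / (1 - q)) * B.
Proof.
move=> q0 q1 kN hb B0; rewrite /half_pairing opprD addrACA subrr add0r.
rewrite (big_cat_nat (leq0n k) kN) /= [X in cnorm X]addrC addKr.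
apply: le_trans (cnorm_sum _ _ _) _.
apply: le_trans (_ : \sum_(k <= j < N) 2 * q * B * q ^+ j <= _).
  rewrite big_nat [leRHS]big_nat; apply: ler_sum => j /andP[_ jN].
  rewrite cnormM cnorm_realC.
  have -> : 2 * q * B * q ^+ j = B * (2 * q ^+ j.+1) by rewrite exprS; ring.
  apply: ler_pM => //; [exact: cnorm_ge0|exact: hb|].
  by apply: cnorm_wave; exact: ltW.
rewrite -mulr_sumr.
have -> : 2 * (q ^+ k.+1 / (1 - q)) * B = 2 * q * B * (q ^+ k / (1 - q)).
  by rewrite exprS; field; lra.
by apply: ler_wpM2l; [rewrite !mulr_ge0 // ltW|exact: sum_geometric_le].
Qed.

(** Square root of the energy bound, with [(1 + x)^m <= e^(m x)]. *)
Lemma euler_coef_le (R : realType) (q s : R) m j :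
  0 < q -> q < 1 -> 0 < s -> (0 < m)%N ->
  `|euler_coef q (s / m%:R) m j.+1| <=
    expR (s * (q^-1 - q) + s ^+ 2 * (2 * q^-1 ^+ 2 + q ^+ 2) / m%:R).
Proof.
move=> q0 q1 s0 m0; have mR0 : 0 < m%:R :> R by rewrite ltr0n.
set h := s / m%:R; have h0 : 0 < h by rewrite divr_gt0.
have qq : 0 <= q^-1 - q := subr_inv_ge0 q0 q1.
rewrite -ler_sqr ?nnegrE ?expR_ge0 // real_normK ?num_real //.
(* Indices above m are not covered by the energy, but the coefficient is 0. *)
case: (ltnP m j.+1) => [mj|jm].
  by rewrite euler_coef_support // expr0n sqr_ge0.
apply: le_trans (half_pairing_le_tail (N := m) _ _) _; first exact: jm.
apply: le_trans (euler_coef_energy q0 q1 (ltW h0) (leqnn m)) _.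
apply: le_trans (expR_ge_powD1 _ _) _.
  rewrite addr_ge0 //; first by rewrite mulr_ge0 ?mulr_ge0 // ltW.
  by rewrite mulr_ge0 ?sqr_ge0 // addr_ge0 // mulr_ge0 // sqr_ge0.
rewrite -expRM_natl ler_expR le_eqVlt; apply/orP; left; apply/eqP.
by rewrite /h; set r := q^-1; field; rewrite gt_eqF.
Qed.

Lemma chebyshev_truncation_error (R : realType) (q s y : R) m k :
  0 < q -> q < 1 -> 0 < s -> (0 < m)%N -> 2 * s <= m%:R -> `|y| <= 2 * s ->
  cnorm (cis y - (chebyshev_truncation q s (s / m%:R) m k).[y%:C]) <=
    2 * (q ^+ k.+1 / (1 - q)) *
      expR (s * (q^-1 - q) + s ^+ 2 * (2 * q^-1 ^+ 2 + q ^+ 2) / m%:R)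
    + 4 * s ^+ 2 * expR (2 * s) / m%:R.
Proof.
move=> q0 q1 s0 m0 sm ys.
have ss0 : 0 < 2 * s by rewrite mulr_gt0.
have [t yt] : exists t, y = 2 * s * cos t.
  exists (acos (y / (2 * s))); rewrite acosK;
    first by rewrite mulrC divfK // gt_eqF.
  by rewrite in_itv /= -ler_norml normrM normfV (gtr0_norm ss0) ler_pdivrMr //
    mul1r.
set P := (1 + 'i * (y / m%:R)%:C) ^+ m.
have -> : cis y - (chebyshev_truncation q s (s / m%:R) m k).[y%:C] =
  (P - (chebyshev_truncation q s (s / m%:R) m k).[y%:C]) + (cis y - P) by ring.
apply: le_trans (cnormD _ _) _; apply: lerD; last exact: cis_euler_power.
(* Expanding P up to index m + k makes it comparable with the truncation even
   when m < k. *)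
rewrite yt horner_chebyshev_truncation ?gt_eqF //.
have -> : P = half_pairing (fun j => (euler_coef q (s / m%:R) m j)%:C)
  (wave q t) (m + k).
  rewrite -euler_power_expansion ?gt_eqF ?leq_addr // /P; congr ((1 + _) ^+ _).
  rewrite yt !(rmorphM, fmorphV, rmorph_nat) /=; ring.
apply: half_pairing_wave_tail => //; first exact: leq_addl.
by move=> j _; exact: euler_coef_le.
Qed.

(** [chebyshev_truncation_error] for a large number of Euler steps. *)
Lemma cis_poly_approx (R : realType) (q s e : R) k :
  0 < q -> q < 1 -> 0 < s -> 0 < e ->
  exists2 p : {poly CC R}, (size p <= k.+1)%N &
    forall y, `|y| <= 2 * s -> cnorm (cis y - p.[y%:C]) <=
      2 * (q ^+ k.+1 / (1 - q)) * expR (s * (q^-1 - q)) + e.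
Proof.
move=> q0 q1 s0 e0.
set A := 2 * (q ^+ k.+1 / (1 - q)); set a := s * (q^-1 - q);
  set C := s ^+ 2 * (2 * q^-1 ^+ 2 + q ^+ 2).
set D := 4 * s ^+ 2 * expR (2 * s).
have h0 c : (fun m : nat => c / m%:R) @ \oo --> (0 : R).
  have hc : (fun m => c * harmonic m) @ \oo --> c * 0.
    by apply: cvgM; [exact: cvg_cst|exact: cvg_harmonic].
  by rewrite mulr0 in hc; rewrite -cvg_shiftS.
have lim : (fun m : nat => A * expR (a + C / m%:R) + D / m%:R) @ \oo --> A *
  expR a + 0.
  apply: cvgD => //; apply: cvgM; first exact: cvg_cst.
  apply: continuous_cvg; first exact: continuous_expR.
  by rewrite -[X in _ --> X]addr0; apply: cvgD => //; exact: cvg_cst.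
have near_lim : \forall m \near \oo, A * expR (a + C / m%:R) + D / m%:R < A *
  expR a + e.
  apply: (cvgr_lt _ lim); by rewrite addr0 ltrDl.
have near_s : \forall m \near \oo, 2 * s <= m%:R :> R by exact: nbhs_infty_ger.
have near_0 : \forall m \near \oo, (0 < m)%N by exact: nbhs_infty_gt.
have [m [[hm hs] m0]] := @filter_ex _ \oo _ _
  (filterI (filterI near_lim near_s) near_0).
exists (chebyshev_truncation q s (s / m%:R) m k).
  exact: size_chebyshev_truncation.
move=> y ys; apply: le_trans _ (ltW hm).
exact: chebyshev_truncation_error.
Qed.

(** Half of the error bound to be proved: the error is the sum of a contribution
    of [H] and one of [T]. *)
Definition cis_bound (R : realType) (q s : R) (k : nat) : R :=
  2 * Num.min (1 / (1 - q ^+ 2)) (s / q) / (1 - q) * q ^+ k *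
    expR (s * (1 / q - q)).

(** For [s <= q] the minimum is [s / q] and the Taylor polynomial is good
    enough. For [q < s] the minimum exceeds [1], which leaves room for the [e]
    of [cis_poly_approx]. *)
Lemma cis_poly_best (R : realType) (q s : R) k :
  0 < q -> q < 1 -> 0 <= s -> (0 < k)%N ->
  exists2 p : {poly CC R}, (size p <= k)%N &
    forall y, `|y| <= 2 * s -> cnorm (cis y - p.[y%:C]) <= cis_bound q s k.
Proof.
move=> q0 q1 s0 k0; rewrite /cis_bound !mul1r.
have q2 : q ^+ 2 < 1 by rewrite expr_lt1 // ltW.
have m1 : 1 < (1 - q ^+ 2)^-1.
  by rewrite invf_gt1 ?subr_gt0 // gtrBl exprn_gt0.
have qq : 0 <= q^-1 - q := subr_inv_ge0 q0 q1.
have G0 : 0 < q ^+ k / (1 - q) by rewrite divr_gt0 ?exprn_gt0 // subr_gt0.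
have E1 : 1 <= expR (s * (q^-1 - q)) by rewrite -expR0 ler_expR mulr_ge0.
set E := expR _ in E1 *; set mu := Num.min _ _.
case: (leP s q) => [sq|qs].
  have -> : mu = s / q.
    rewrite /mu min_r // (le_trans _ (ltW m1)) // ler_pdivrMr ?mul1r //.
  exists (\sum_(0 <= j < k) ((j`!%:R)^-1 * 'i ^+ j) *: 'X^j).
    rewrite big_nat; elim/big_ind: _ => [|p p' hp hp'|j /andP[_ jk]].
    - by rewrite size_poly0.
    - by rewrite (leq_trans (size_polyD _ _)) // geq_max hp.
    - by rewrite (leq_trans (size_scale_leq _ _)) // size_polyXn.
  move=> y ys.
  have -> : (\sum_(0 <= j < k) ((j`!%:R)^-1 * 'i ^+ j) *: 'X^j).[y%:C] =
    expi_sum k y.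
    rewrite horner_sum; apply: eq_bigr => j _.
    by rewrite hornerZ hornerXn exprMn mulrA.
  apply: le_trans (cis_taylor_bound s0 sq q1 q0 ys k0) _.
  have -> : 2 * (s / q) / (1 - q) * q ^+ k * E = 2 * (s / q) *
    (q ^+ k / (1 - q)) * E.
    by ring.
  apply: ler_peMr => //; apply: mulr_ge0; last exact: ltW.
  by rewrite mulr_ge0 // divr_ge0 // ltW.
have mu1 : 1 < mu by rewrite lt_min m1 ltr_pdivlMr // mul1r.
pose e := 2 * (mu - 1) * (q ^+ k / (1 - q)) * E.
have e0 : 0 < e.
  rewrite mulr_gt0 ?(lt_le_trans ltr01 E1) // mulr_gt0 // mulr_gt0 //
    subr_gt0 //.
have [p sp hp] := cis_poly_approx k.-1 q0 q1 (lt_trans q0 qs) e0.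
rewrite prednK // in sp hp.
exists p => // y ys; apply: le_trans (hp y ys) _.
rewrite -/E /e le_eqVlt; apply/orP; left; apply/eqP; ring.
Qed.

(** Centre the interval at [c = (a + b) / 2] and take out the factor
    [e^(i tau c)], of modulus [1]. *)
Lemma cis_poly_interval (R : realType) (q tau a b : R) k :
  0 < q -> q < 1 -> 0 <= tau -> a <= b -> (0 < k)%N ->
  exists2 p : {poly CC R}, (size p <= k)%N &
    forall x, a <= x <= b -> cnorm (cis (tau * x) - p.[x%:C]) <=
       cis_bound q (tau * ((b - a) / 4)) k.
Proof.
move=> q0 q1 t0 ab k0.
have s0 : 0 <= tau * ((b - a) / 4) by rewrite mulr_ge0 // divr_ge0 // subr_ge0.
have [p sp hp] := cis_poly_best q0 q1 s0 k0.
pose c := (a + b) / 2.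
exists (cis (tau * c) *: (p \Po ((tau%:C) *: ('X - (c%:C)%:P)))).
  rewrite (leq_trans (size_scale_leq _ _)) //.
  rewrite (leq_trans (size_comp_poly_leq _ _)) //.
  case: (size p) sp => [|n] nk; first by rewrite mul0n.
  apply: leq_trans nk; rewrite ltnS -[leqRHS]muln1; apply: leq_mul => //.
  by rewrite -subn1 leq_subLR (leq_trans (size_scale_leq _ _)) // size_XsubC.
move=> x /andP[ax xb].
rewrite hornerZ horner_comp hornerZ hornerXsubC.
have -> : tau%:C * (x%:C - c%:C) = (tau * (x - c))%:C :> CC R.
  by rewrite [RHS](rmorphM (real_complex R)) (rmorphB (real_complex R)).
have -> : tau * x = tau * c + tau * (x - c) by ring.
rewrite cisD -mulrBr cnormM cnorm_cis mul1r; apply: hp.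
rewrite normrM ger0_norm // [leRHS]mulrCA; apply: ler_wpM2l => //.
rewrite ler_norml /c; apply/andP; split; lra.
Qed.

(** * Functions of Hermitian matrices *)

Lemma sqr_l2norm (R : realType) n (x : 'cV[CC R]_n) :
  l2norm x ^+ 2 = \sum_(i < n) cnorm (x i 0) ^+ 2.
Proof. by rewrite sqr_sqrtr // sumr_ge0 // => i _; rewrite sqr_ge0. Qed.

Lemma sqr_cnorm (R : realType) (z : CC R) : (cnorm z ^+ 2)%:C = z^* * z.
Proof. by rewrite -normCKC [`|z|]normc_def; case: z => a b;
  rewrite rmorphXn. Qed.

Lemma sqr_l2normC (R : realType) n (x : 'cV[CC R]_n) :
  (l2norm x ^+ 2)%:C = (x^t* *m x) 0 0.
Proof.
rewrite sqr_l2norm rmorph_sum mxE; apply: eq_bigr => i _.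
by rewrite /= sqr_cnorm !mxE.
Qed.

Lemma l2norm_ge0 (R : realType) n (x : 'cV[CC R]_n) : 0 <= l2norm x.
Proof. exact: sqrtr_ge0. Qed.

Lemma l2norm_isometry (R : realType) m n (B : 'M[CC R]_(m, n))
    (x : 'cV[CC R]_n) :
  B^t* *m B = 1%:M -> l2norm (B *m x) = l2norm x.
Proof.
move=> hB; apply/eqP; rewrite -(eqrXn2 (n := 2)) ?l2norm_ge0 //; apply/eqP.
apply: complexI; rewrite !sqr_l2normC trmx_mul map_mxM -mulmxA.
by rewrite (mulmxA _ B) hB mul1mx.
Qed.

(** Entrywise [|a - b|^2 <= 2 |a|^2 + 2 |b|^2]; this suffices for equal bounds
    on the two vectors and avoids the triangle inequality in dimension [n]. *)
Lemma l2normB_le (R : realType) n (x y : 'cV[CC R]_n) (c : R) :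
  l2norm x <= c -> l2norm y <= c -> l2norm (x - y) <= 2 * c.
Proof.
move=> xc yc; have c0 : 0 <= c := le_trans (l2norm_ge0 x) xc.
have {}xc : l2norm x ^+ 2 <= c ^+ 2 by apply: lerXn2r;
  rewrite ?nnegrE ?l2norm_ge0.
have {}yc : l2norm y ^+ 2 <= c ^+ 2 by apply: lerXn2r;
  rewrite ?nnegrE ?l2norm_ge0.
rewrite -ler_sqr ?nnegrE ?l2norm_ge0 ?mulr_ge0 //.
apply: le_trans (_ : 2 * l2norm x ^+ 2 + 2 * l2norm y ^+ 2 <= _); last lra.
rewrite !sqr_l2norm !mulr_sumr -big_split /=; apply: ler_sum => i _.
rewrite !mxE; set a := x i 0; set b := y i 0.
have : cnorm (a - b) ^+ 2 <= (cnorm a + cnorm b) ^+ 2.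
  apply: lerXn2r; rewrite ?nnegrE ?addr_ge0 ?cnorm_ge0 //.
  by apply: le_trans (cnormD _ _) _; rewrite cnormN.
have := sqr_ge0 (cnorm a - cnorm b); lra.
Qed.

(** The value of a function at a unitarily diagonalizable matrix, [f i] being
    its value at the eigenvalue of index [i]. *)
Definition unitary_conj (R : realType) n (U : 'M[CC R]_n) (f : 'I_n -> CC R) :
    'M[CC R]_n :=
  U^t* *m diag_mx (\row_i f i) *m U.

Lemma unitary_conjE (R : realType) n (U : 'M[CC R]_n) (f : 'I_n -> CC R) :
  unitary_conj U f = \sum_i f i *: (U^t* *m delta_mx i i *m U).
Proof.
rewrite /unitary_conj diag_mx_sum_delta mulmx_sumr mulmx_suml.
by apply: eq_bigr => i _; rewrite mxE -scalemxAr -scalemxAl.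
Qed.

Lemma unitary_conjX (R : realType) n (U : 'M[CC R]_n) (f : 'I_n -> CC R) j :
  U *m U^t* = 1%:M -> U^t* *m U = 1%:M ->
  unitary_conj U f ^+ j = unitary_conj U (fun i => f i ^+ j).
Proof.
move=> UU' U'U; elim: j => [|j IH].
  rewrite expr0 /unitary_conj.
  have -> : diag_mx (\row_i f i ^+ 0) = 1%:M.
    by rewrite -diag_const_mx; congr diag_mx; apply/rowP => i; rewrite !mxE.
  by rewrite mulmx1 U'U.
rewrite exprS IH /unitary_conj -[_ * _]/(_ *m _).
rewrite !mulmxA -(mulmxA _ U) UU' mulmx1 -(mulmxA _ (diag_mx _) (diag_mx _))
  mulmx_diag.
by congr (_ *m diag_mx _ *m _); apply/rowP => i; rewrite !mxE exprS.
Qed.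

Lemma unitary_conjD (R : realType) n (U : 'M[CC R]_n) (f g : 'I_n -> CC R) :
  unitary_conj U (fun i => f i - g i) = unitary_conj U f - unitary_conj U g.
Proof.
rewrite !unitary_conjE -sumrB; apply: eq_bigr => i _.
by rewrite scalerBl.
Qed.

Lemma unitary_conj_lincomb (R : realType) n (U : 'M[CC R]_n) (I : Type)
    (r : seq I) (P : pred I) (c : I -> CC R) (f : I -> 'I_n -> CC R) :
  \sum_(j <- r | P j) c j *: unitary_conj U (f j) =
    unitary_conj U (fun i => \sum_(j <- r | P j) c j * f j i).
Proof.
rewrite unitary_conjE.
under eq_bigr do rewrite unitary_conjE scaler_sumr.
rewrite exchange_big; apply: eq_bigr => i _.
by rewrite scaler_suml; apply: eq_bigr => j _; rewrite scalerA.
Qed.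

Lemma unitary_conj_bound (R : realType) n (U : 'M[CC R]_n) (f : 'I_n -> CC R)
    (c : R) (x : 'cV[CC R]_n) :
  U *m U^t* = 1%:M -> U^t* *m U = 1%:M -> 0 <= c ->
  (forall i, cnorm (f i) <= c) ->
  l2norm (unitary_conj U f *m x) <= c * l2norm x.
Proof.
move=> UU' U'U c0 fc; rewrite /unitary_conj -!mulmxA l2norm_isometry;
  last first.
  by rewrite trmxCK.
rewrite -(l2norm_isometry x U'U) -ler_sqr ?nnegrE ?mulr_ge0 ?l2norm_ge0 //.
rewrite exprMn !sqr_l2norm mulr_sumr; apply: ler_sum => i _.
rewrite mul_diag_mx !mxE cnormM exprMn; apply: ler_wpM2r; first exact: sqr_ge0.
by apply: lerXn2r; rewrite ?nnegrE ?cnorm_ge0.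
Qed.

Lemma hermitian_diagonalization (R : realType) n (H : 'M[CC R]_n) :
  H^t* = H -> exists (U : 'M[CC R]_n) (d : 'I_n -> R),
    [/\ U *m U^t* = 1%:M, U^t* *m U = 1%:M &
      H = unitary_conj U (fun i => (d i)%:C)].
Proof.
move=> hH; have hH' : H \is hermsymmx.
  by apply/is_hermitianmxP; rewrite expr0 scale1r.
have /orthomx_spectralP eH := hermitian_normalmx hH'.
have hU := spectral_unitarymx H.
have dR := hermitian_spectral_diag_real hH'.
exists (spectralmx H), (fun i => complex.Re (spectral_diag H 0 i)); split.
- by apply/eqP; move: hU; rewrite qualifE.
- have /unitarymxP : (spectralmx H)^t* \is unitarymx by rewrite trmxC_unitary.
  by rewrite trmxCK.
rewrite {1}eH invmx_unitary // /unitary_conj; congr (_ *m diag_mx _ *m _).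
apply/rowP => i; rewrite mxE RRe_real //.
by move/mxOverP: dR => /(_ 0 i).
Qed.

Lemma expi_sum_cvgC (R : realType) (y : R) :
  (fun N => expi_sum N y) @ \oo --> cis y.
Proof.
apply/cvgrPdist_lt => eps eps0.
have epsR : (complex.Re eps)%:C = eps by rewrite RRe_real // gtr0_real.
have e0 : 0 < complex.Re eps by rewrite -ltcR epsR.
have h : \forall N \near \oo, cnorm (cis y - expi_sum N y) < complex.Re eps.
  exact: (cvgr_lt _ (expi_sum_cvg y)).
apply: filterS h => N hN; rewrite -epsR.
have -> : `|cis y - expi_sum N y| = (cnorm (cis y - expi_sum N y))%:C.
  by rewrite [LHS]normc_def; case: (_ - _).
by rewrite ltcR.
Qed.

(** The partial sums are linear combinations of fixed matrices, with the partial
    sums of [e^(i tau d_i)] as coefficients. *)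
Lemma expmx_unitary_conj (R : realType) n (U : 'M[CC R]_n) (d : 'I_n -> R)
    (tau : R) :
  (0 < n)%N -> U *m U^t* = 1%:M -> U^t* *m U = 1%:M ->
  expmx (('i * tau%:C) *: unitary_conj U (fun i => (d i)%:C)) =
    unitary_conj U (fun i => cis (tau * d i)).
Proof.
case: n U d => // n U d _ UU' U'U; rewrite /expmx.
apply: cvg_lim; first exact: norm_hausdorff.
have -> : series (fun j => (j`!%:R)^-1 *:
    (('i * tau%:C) *: unitary_conj U (fun i => (d i)%:C)) ^+ j) =
  (fun N => \sum_i expi_sum N (tau * d i) *: (U^t* *m delta_mx i i *m U)).
  apply/funext => N; rewrite -unitary_conjE /series /=.
  under eq_bigr do rewrite exprZn unitary_conjX // scalerA.
  rewrite unitary_conj_lincomb; congr unitary_conj; apply/funext => i.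
  apply: eq_bigr => j _.
  by rewrite -mulrA -exprMn -[in LHS]mulrA -(rmorphM (real_complex R)).
rewrite unitary_conjE; apply: cvg_big => [|i _]; first exact: add_continuous.
by apply: cvgZl; exact: expi_sum_cvgC.
Qed.

(** The sum applies to matrices of arbitrary size [n], including [0], where
    ['M_n] is the zero ring. *)
Definition poly_mx (R : realType) n (p : {poly CC R})
    (M : 'M[CC R]_n) : 'M[CC R]_n :=
  \sum_(j < size p) p`_j *: M ^+ j.

Lemma poly_mx_unitary_conj (R : realType) n (U : 'M[CC R]_n) (f : 'I_n -> CC R)
    (p : {poly CC R}) :
  U *m U^t* = 1%:M -> U^t* *m U = 1%:M ->
  poly_mx p (unitary_conj U f) = unitary_conj U (fun i => p.[f i]).
Proof.
move=> UU' U'U; rewrite /poly_mx.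
under eq_bigr do rewrite unitary_conjX //.
rewrite unitary_conj_lincomb; congr unitary_conj; apply/funext => i.
by rewrite horner_coef.
Qed.

Lemma expmx_poly_mx_bound (R : realType) n (U : 'M[CC R]_n) (d : 'I_n -> R)
    (p : {poly CC R}) (tau c : R) (x : 'cV[CC R]_n) :
  (0 < n)%N -> U *m U^t* = 1%:M -> U^t* *m U = 1%:M -> 0 <= c ->
  (forall i, cnorm (cis (tau * d i) - p.[(d i)%:C]) <= c) ->
  let M := unitary_conj U (fun i => (d i)%:C) in
  l2norm ((expmx (('i * tau%:C) *: M) - poly_mx p M) *m x) <= c * l2norm x.
Proof.
move=> n0 UU' U'U c0 hc /=.
rewrite expmx_unitary_conj // poly_mx_unitary_conj // -unitary_conjD.
exact: unitary_conj_bound.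
Qed.

(** * Spectrum of a compression and the Lanczos projection *)

(** Row [i] of [U] is an eigenvector. *)
Lemma unitary_conj_eigenvalue (R : realType) n (U : 'M[CC R]_n)
    (f : 'I_n -> CC R) i :
  U *m U^t* = 1%:M -> eigenvalue (unitary_conj U f) (f i).
Proof.
move=> UU'; apply/eigenvalueP; exists (row i U); last first.
  apply/eqP => r0; have : row i (U *m U^t*) = 0 by rewrite row_mul r0 mul0mx.
  rewrite UU' row1 => /rowP /(_ i); rewrite !mxE !eqxx => /eqP.
  by rewrite oner_eq0.
rewrite /unitary_conj -row_mul !mulmxA UU' mul1mx mul_diag_mx.
by apply/rowP => j; rewrite !mxE.
Qed.

(** With [Z = U V W^*], an isometry, [diag t = Z^* diag(d) Z]: each [t i] is the
    average of the [d l] with weights [|Z l i|^2], which add up to [1]. *)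
Lemma compression_eigenvalues_in (R : realType) n k (U : 'M[CC R]_n)
    (W : 'M[CC R]_k) (V : 'M[CC R]_(n, k)) (d : 'I_n -> R) (t : 'I_k -> R)
    (a b : R) :
  U^t* *m U = 1%:M -> W *m W^t* = 1%:M -> V^t* *m V = 1%:M ->
  unitary_conj W (fun i => (t i)%:C) =
    V^t* *m unitary_conj U (fun i => (d i)%:C) *m V ->
  (forall i, a <= d i <= b) -> forall i, a <= t i <= b.
Proof.
move=> U'U WW' V'V eT dab i.
pose Z := U *m V *m W^t*.
have Z' : Z^t* = W *m V^t* *m U^t*
  by rewrite !trmx_mul !map_mxM -!mulmxA trmxCK.
have Z'Z : Z^t* *m Z = 1%:M.
  by rewrite Z' /Z !mulmxA -(mulmxA _ _ U) U'U mulmx1 -(mulmxA _ _ V) V'V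
    mulmx1.
have eD : diag_mx (\row_i (t i)%:C) = Z^t* *m diag_mx (\row_i (d i)%:C) *m Z.
  have -> : diag_mx (\row_i (t i)%:C) = W *m unitary_conj W (fun i => (t i)%:C)
    *m W^t*.
    by rewrite /unitary_conj !mulmxA WW' mul1mx -mulmxA WW' mulmx1.
  by rewrite eT Z' /Z /unitary_conj !mulmxA.
have sum1 : \sum_l cnorm (Z l i) ^+ 2 = 1.
  apply: complexI; rewrite rmorph_sum rmorph1.
  have /matrixP /(_ i i) := Z'Z; rewrite !mxE eqxx mulr1n => <-.
  by apply: eq_bigr => l _; rewrite /= sqr_cnorm !mxE.
have tE : t i = \sum_l d l * cnorm (Z l i) ^+ 2.
  apply: complexI; rewrite rmorph_sum.
  have /matrixP /(_ i i) := eD;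
    rewrite -mulmxA mul_diag_mx !mxE eqxx mulr1n => ->.
  apply: eq_bigr => l _; rewrite !mxE rmorphM /= sqr_cnorm; ring.
have [ha hb] : (forall l, a <= d l) /\ (forall l, d l <= b).
  by split=> l; case/andP: (dab l).
rewrite tE -[a]mulr1 -[b]mulr1 -sum1 !mulr_sumr; apply/andP; split.
  by apply: ler_sum => l _; apply: ler_wpM2r => //; exact: sqr_ge0.
by apply: ler_sum => l _; apply: ler_wpM2r => //; exact: sqr_ge0.
Qed.

(** Each application of a tridiagonal matrix moves the support by at most one
    index. *)
Lemma tridiagonal_power_first (R : realType) k (T : 'M[CC R]_k) j (i : 'I_k) :
  tridiagonal T -> (j < i)%N -> (T ^+ j *m evec_first R k) i 0 = 0.
Proof.
move=> hT; elim: j i => [|j IH] i ji.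
  by rewrite expr0 mul1mx mxE gtn_eqF.
rewrite exprS -[_ * _]/(_ *m _) -mulmxA mxE big1 // => l _.
have [jl|lj] := ltnP j l; first by rewrite IH // mulr0.
by rewrite hT ?mul0r //; apply/orP; right; apply: leq_trans ji.
Qed.

(** The remainder [u e_k^T] is multiplied by the last entry of
    [T ^+ j *m e_1], which vanishes as long as [j.+1 < k]. *)
Lemma krylov_projection (R : realType) n k (H : 'M[CC R]_n)
    (V : 'M[CC R]_(n, k))
    (T : 'M[CC R]_k) (b : CC R) (u : 'cV[CC R]_n) j :
  tridiagonal T -> H *m V = V *m T + b *: (u *m (evec_last R k)^T) ->
  (j < k)%N ->
  H ^+ j *m (V *m evec_first R k) = V *m (T ^+ j *m evec_first R k).
Proof.
move=> hT hV; elim: j => [|j IH] jk; first by rewrite !expr0 !mul1mx.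
rewrite !exprS -[_ * _]/(_ *m _) -[T * _]/(_ *m _) -mulmxA IH ?(ltnW jk) //.
rewrite mulmxA hV mulmxDl -!mulmxA -[RHS]addr0; congr (_ + _).
rewrite -scalemxAl -mulmxA.
have -> : (evec_last R k)^T *m (T ^+ j *m evec_first R k) = 0.
  apply/matrixP => a c; rewrite !ord1 mxE big1 ?mxE // => l _; rewrite !mxE.
  case: eqP => [lk|_]; last by rewrite mul0r.
  by have := @tridiagonal_power_first R k T j l hT; rewrite -ltnS lk mxE => ->;
    rewrite ?mulr0.
by rewrite mulmx0 scaler0.
Qed.

Lemma poly_mx_projection (R : realType) n k (H : 'M[CC R]_n)
    (V : 'M[CC R]_(n, k))
    (T : 'M[CC R]_k) (b : CC R) (u : 'cV[CC R]_n) (p : {poly CC R}) :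
  tridiagonal T -> H *m V = V *m T + b *: (u *m (evec_last R k)^T) ->
  (size p <= k)%N ->
  poly_mx p H *m (V *m evec_first R k) = V *m (poly_mx p T *m evec_first R k).
Proof.
move=> hT hV pk; rewrite /poly_mx !mulmx_suml mulmx_sumr; apply: eq_bigr => j _.
rewrite -!scalemxAl -scalemxAr (krylov_projection hT hV) //.
exact: leq_trans pk.
Qed.

(** * The error bound *)

Theorem theorem6p1 (R : realType) (n : nat) (A H : 'M[CC R]_n)
    (hAH : A = - 'i *: H) (hA : A^t* = - A)
    (v : 'cV[CC R]_n) (hv : l2norm v = 1)
    (tau : R) (htau : 0 < tau)
    (k : nat) (hk : (0 < k)%N)
    (V : 'M[CC R]_(n, k)) (T : 'M[CC R]_k) (beta : R) (u : 'cV[CC R]_n)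
    (hL : lanczos H v V T beta u)
    (lmin lmax : R) (hmin : is_lambda_min H lmin) (hmax : is_lambda_max H lmax)
    (q : R) (hq0 : 0 < q) (hq1 : q < 1) :
  let rho := (lmax - lmin) / 4 in
  l2norm (expmx (('i * tau%:C) *: H) *m v - lanczos_approx V T tau) <=
    4 * Num.min (1 / (1 - q ^+ 2)) (tau * rho / q) / (1 - q) * q ^+ k *
      expR (tau * rho * (1 / q - q)).
Proof.
cbv zeta; set rho := (lmax - lmin) / 4.
have hH : H^t* = H.
  have eH : H = 'i *: A.
    by rewrite hAH scalerA mulrN -expr2 sqrCi opprK scale1r.
  have conjZ : H^t* = 'i^* *: A^t*.
    by rewrite eH; apply/matrixP => i j; rewrite !mxE rmorphM.
  by rewrite conjZ hA conjCi scalerN scaleNr opprK -eH.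
case: hL => [hVe [hV _] hT eT _ hrel _].
have n0 : (0 < n)%N.
  rewrite lt0n; apply/eqP => n_eq0; have := sqr_l2norm v.
  rewrite hv expr1n big1 => [/eqP|[i lt_in]]; first by rewrite oner_eq0.
  by exfalso; rewrite n_eq0 in lt_in.
have hTh : T^t* = T.
  by rewrite eT !trmx_mul !map_mxM trmxCK hH mulmxA.
have [U [d [UU' U'U eHd]]] := hermitian_diagonalization hH.
have [W [t [WW' W'W eTt]]] := hermitian_diagonalization hTh.
have dab i : lmin <= d i <= lmax.
  have ev : eigenvalue H (d i)%:C.
    rewrite eHd; exact: (unitary_conj_eigenvalue (fun i => (d i)%:C)).
  by rewrite hmin.2 // hmax.2.
have tab : forall i, lmin <= t i <= lmax.
  apply: (compression_eigenvalues_in U'U WW' hV _ dab).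
  by rewrite -eTt -eHd.
have lele : lmin <= lmax by apply: hmax.2; case: hmin.
have [p sp hp] := cis_poly_interval hq0 hq1 (ltW htau) lele hk.
rewrite -/rho in hp.
have B0 : 0 <= cis_bound q (tau * rho) k.
  apply: le_trans (cnorm_ge0 _) (hp lmin _); by rewrite lexx.
have e1 : l2norm (evec_first R k) = 1 by rewrite -hv -hVe l2norm_isometry.
have errH := expmx_poly_mx_bound v n0 UU' U'U B0 (fun i => hp _ (dab i)).
have errT := expmx_poly_mx_bound (evec_first R k) hk WW' W'W B0
  (fun i => hp _ (tab i)).
rewrite /= -eHd hv mulr1 in errH; rewrite /= -eTt e1 mulr1 in errT.
rewrite -(l2norm_isometry _ hV) in errT.
apply: le_trans (_ : 2 * cis_bound q (tau * rho) k <= _); last first.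
  rewrite /cis_bound le_eqVlt; apply/orP; left; apply/eqP; ring.
apply: le_trans (l2normB_le errH errT); rewrite le_eqVlt; apply/orP; left;
  apply/eqP.
congr l2norm; rewrite !mulmxBl mulmxBr.
have <- : poly_mx p H *m v = V *m (poly_mx p T *m evec_first R k).
  by rewrite -hVe; exact: (poly_mx_projection hT hrel sp).
by rewrite /lanczos_approx -mulmxA opprB addrA subrK.
Qed.
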